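(* Suppose that $g$ is Lipschitz continuous on $\mathbb R^m$ and that the dual center $\dot y=\bar y^c$ is the prox-center of $p_{\mathcal Y}$, so that $D_{\mathcal Y}:=\sup_y\{b_{\mathcal Y}(y,\dot y)\mid y\in\mathrm{dom}(g^* )\}<+\infty$. Let $b_{\mathcal X}$ be chosen such that $L_{b_{\mathcal X}}=1$, and let $\{\bar w^k\}=\{(\bar x^k,\bar y^k)\}$ be the sequence generated by Algorithm 2 (ADSGARD, described in the context), where $\gamma_1>0$ is given. Then for all $k\ge1$ and every primal solution $x^\star\in\mathcal X^\star$, $$P(\bar x^k)-P^\star\le\frac{2\gamma_1}{k+1}b_{\mathcal X}(x^\star,\dot x)+\frac{2\bar L_A}{\gamma_1k}D_{\mathcal Y}.$$
   Context: Setting. $f:\mathbb R^n\to\mathbb R\cup\{+\infty\}$ and $g:\mathbb R^m\to\mathbb R\cup\{+\infty\}$ are proper, closed, convex, and $A\in\mathbb R^{m\times n}$ is nonzero. Primal problem: $P^\star=\min_{x\in\mathbb R^n}\{P(x):=f(x)+g(Ax)\}$, solution set $\mathcal X^\star$. $g^*$ is the Fenchel conjugate of $g$. Put $\mathcal X:=\overline{\mathrm{dom}(f)}$, $\mathcal Y:=\overline{\mathrm{dom}(g^* )}$. Standing assumption: $\mathcal X^\star\ne\emptyset$ and $0\in\mathrm{ri}(\mathrm{dom}(g)-A(\mathrm{dom} f))$. Norms. $\|\cdot\|_{\mathcal X}$, $\|\cdot\|_{\mathcal Y}$ are weighted Euclidean norms on $\mathbb R^n$, $\mathbb R^m$ (of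 the form $\|z\|=\|Sz\|_2$ with $S^\top S$ positive definite), with dual norms $\|u\|_{\cdot,*}=\max\{\langle u,v\rangle:\|v\|=1\}$. $\bar L_A:=\|A\|^2=\max_{x}\|Ax\|_{\mathcal Y,*}^2/\|x\|_{\mathcal X}^2$. Bregman distances. For $\mathcal Z\in\{\mathcal X,\mathcal Y\}$, $p_{\mathcal Z}$ is continuous, $1$-strongly convex and differentiable with $L_{b_{\mathcal Z}}$-Lipschitz gradient with respect to $\|\cdot\|_{\mathcal Z}$ ($L_{b_{\mathcal Z}}\ge1$), $\mathcal Z\subseteq\mathrm{dom}(p_{\mathcal Z})$, and $b_{\mathcal Z}(z,\dot z)=p_{\mathcal Z}(z)-p_{\mathcal Z}(\dot z)-\langle\nabla p_{\mathcal Z}(\dot z),z-\dot z\rangle$. The prox-center of $p_{\mathcal Y}$ is $\bar y^c:=\arg\min\{p_{\mathcal Y}(y):y\in\mathrm{dom}(p_{\mathcal Y})\}$, normalized so that $p_{\mathcal Y}(\bar y^c)=0$. Algorithm 2 (ADSGARD). Given $\dot x\in\mathcal X$, $\dot y$, $\gamma_1>0$; set $\beta_1:=\bar L_A/\gamma_1$, $\tau_0:=1$, $\bar y^*_0:=\dot y$ (since $\tau_0=1$, the values $\bar x^0,\bar y^0$ are irrelevant). For $k=0,1,2,\dots$: (1) $\hat y^k:=(1-\tau_k)\bar y^k+\tau_k\bar y^*_k$; (2) $\hat x^*_{k+1}:=\arg\min_{x\in\mathcal X}\{f(x)+\langle A^\top\hat y^k,x\rangle+\gamma_{k+1}b_{\mathcal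 X}(x,\dot x)\}$; (3) $\bar y^{k+1}:=\arg\min_{y}\{g^*(y)-\langle A\hat x^*_{k+1},y-\hat y^k\rangle+\frac{\bar L_A}{2\gamma_{k+1}}\|y-\hat y^k\|_{\mathcal Y}^2\}$ (for the Euclidean norm this is $\mathrm{prox}_{\gamma_{k+1}\bar L_A^{-1}g^*}(\hat y^k+\gamma_{k+1}\bar L_A^{-1}A\hat x^*_{k+1})$); (4) $\bar x^{k+1}:=(1-\tau_k)\bar x^k+\tau_k\hat x^*_{k+1}$; (5) $\bar y^*_{k+1}:=\arg\max_{y\in\mathcal Y}\{\langle A\bar x^{k+1},y\rangle-g^*(y)-\beta_{k+1}b_{\mathcal Y}(y,\dot y)\}$; (6) $\tau_{k+1}\in(0,1)$ is the unique positive root of $\tau^3/L_{b_{\mathcal X}}+\tau^2+\tau_k^2\tau-\tau_k^2=0$; (7) $\gamma_{k+2}:=\gamma_{k+1}/(1+L_{b_{\mathcal X}}^{-1}\tau_{k+1})$ and $\beta_{k+2}:=(1-\tau_{k+1})\beta_{k+1}$. *)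

(* Defs.v *)
From mathcomp Require Import all_boot all_order all_algebra.
From mathcomp Require Import all_classical all_reals all_analysis.

Set Implicit Arguments.
Unset Strict Implicit.
Unset Printing Implicit Defensive.

Import Order.TTheory GRing.Theory Num.Theory.
Import numFieldNormedType.Exports.

Local Open Scope classical_set_scope.
Local Open Scope ring_scope.

Definition dotv (R : realType) (n : nat) (u v : 'cV[R]_n) : R :=
  \sum_(i < n) u i 0 * v i 0.

Definition posdef (R : realType) (n : nat) (M : 'M[R]_n) : Prop :=
  forall z : 'cV[R]_n, z != 0 -> 0 < dotv z (M *m z).

Definition wnorm (R : realType) (q n : nat) (S : 'M[R]_(q, n))
    (z : 'cV[R]_n) : R :=
  Num.sqrt (dotv (S *m z) (S *m z)).

Definition dual_norm (R : realType) (n : nat) (nrm : 'cV[R]_n -> R)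
    (u : 'cV[R]_n) : R :=
  sup [set dotv u v | v in [set v | nrm v = 1]].

Definition opnorm_sq (R : realType) (n m : nat) (nrmX : 'cV[R]_n -> R)
    (nrmY : 'cV[R]_m -> R) (A : 'M[R]_(m, n)) : R :=
  sup [set dual_norm nrmY (A *m x) ^+ 2 / nrmX x ^+ 2 | x in [set x | x != 0]].

Definition dom (R : realType) (n : nat) (f : 'cV[R]_n -> \bar R) :
    set 'cV[R]_n := [set x | (f x < +oo)%E].

Definition proper (R : realType) (n : nat) (f : 'cV[R]_n -> \bar R) : Prop :=
  (forall x, (-oo < f x)%E) /\ dom f !=set0.

(* The weights t and 1 - t are positive, so for a function that never takes the
   value -oo no indeterminate form occurs. *)
Definition strongly_convex (R : realType) (n : nat) (nrm : 'cV[R]_n -> R)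
    (mu : R) (f : 'cV[R]_n -> \bar R) : Prop :=
  forall (x y : 'cV[R]_n) (t : R), 0 < t < 1 ->
    (f (t *: x + (1 - t) *: y)%R
       + (mu / 2 * t * (1 - t) * nrm (x - y) ^+ 2)%:E
     <= t%:E * f x + (1 - t)%:E * f y)%E.

Definition convex_ext (R : realType) (n : nat) (f : 'cV[R]_n -> \bar R) :
    Prop :=
  forall (x y : 'cV[R]_n) (t : R), 0 < t < 1 ->
    (f (t *: x + (1 - t) *: y)%R <= t%:E * f x + (1 - t)%:E * f y)%E.

(* A proper convex function is closed iff it is lower semicontinuous. *)
Definition proper_closed_convex (R : realType) (n : nat)
    (f : 'cV[R]_n -> \bar R) : Prop :=
  [/\ proper f, lower_semicontinuous f & convex_ext f].

Definition conjugate (R : realType) (n : nat) (f : 'cV[R]_n -> \bar R)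
    (y : 'cV[R]_n) : \bar R :=
  ereal_sup [set ((dotv y u)%:E - f u)%E | u in setT].

Definition affine_hull (R : realType) (n : nat) (C : set 'cV[R]_n) :
    set 'cV[R]_n :=
  [set x | exists (k : nat) (c : 'I_k -> R) (z : 'I_k -> 'cV[R]_n),
     [/\ forall i, C (z i), \sum_(i < k) c i = 1
       & x = \sum_(i < k) c i *: z i]].

Definition relint (R : realType) (n : nat) (C : set 'cV[R]_n) :
    set 'cV[R]_n :=
  [set x | C x /\ \forall y \near x, affine_hull C y -> C y].

(* Lipschitz continuity on the whole space includes finiteness everywhere; the
   choice of norm only affects the constant. *)
Definition lipschitz_ext (R : realType) (n : nat) (f : 'cV[R]_n -> \bar R) :
    Prop :=
  (forall x, f x \is a fin_num) /\ [lipschitz fine (f x) | x in setT].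

Definition argmin (R : realType) (T : Type) (D : set T) (F : T -> \bar R) :
    set T :=
  [set x | D x /\ forall z, D z -> (F x <= F z)%E].

Definition argmax (R : realType) (T : Type) (D : set T) (F : T -> \bar R) :
    set T :=
  [set x | D x /\ forall z, D z -> (F z <= F x)%E].

(* Differentiability relative to D, with gradient map dp: at interior points of D
   this is Frechet differentiability, and it remains meaningful at points of D
   that are not interior. *)
Definition gradient_on (R : realType) (n : nat) (D : set 'cV[R]_n)
    (p : 'cV[R]_n -> R) (dp : 'cV[R]_n -> 'cV[R]_n) : Prop :=
  forall z, D z ->
    (p w - p z - dotv (dp z) (w - z)) / `|w - z|
      @[w --> within D z^'] --> (0 : R).

Record prox_function (R : realType) (n : nat) (nrm : 'cV[R]_n -> R)
    (Z : set 'cV[R]_n) (p : 'cV[R]_n -> \bar R) (dp : 'cV[R]_n -> 'cV[R]_n)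
    (L : R) : Prop := ProxFunction {
  prox_proper : proper p;
  prox_sub_dom : Z `<=` dom p;
  prox_continuous : {within dom p, continuous (fun z => fine (p z))};
  prox_strongly_convex : strongly_convex nrm 1 p;
  prox_gradient : gradient_on (dom p) (fun z => fine (p z)) dp;
  prox_lipschitz_gradient : forall z z', dom p z -> dom p z' ->
    dual_norm nrm (dp z - dp z') <= L * nrm (z - z');
  prox_constant_ge1 : 1 <= L
}.

Definition bregman (R : realType) (n : nat) (p : 'cV[R]_n -> \bar R)
    (dp : 'cV[R]_n -> 'cV[R]_n) (z zdot : 'cV[R]_n) : \bar R :=
  (p z - p zdot - (dotv (dp zdot) (z - zdot))%:E)%E.

Definition normalized_prox_center (R : realType) (n : nat)
    (p : 'cV[R]_n -> \bar R) (c : 'cV[R]_n) : Prop :=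
  argmin (dom p) p c /\ p c = 0%E.

Definition primal (R : realType) (n m : nat) (f : 'cV[R]_n -> \bar R)
    (g : 'cV[R]_m -> \bar R) (A : 'M[R]_(m, n)) (x : 'cV[R]_n) : \bar R :=
  (f x + g (A *m x)%R)%E.

Definition primal_opt (R : realType) (n m : nat) (f : 'cV[R]_n -> \bar R)
    (g : 'cV[R]_m -> \bar R) (A : 'M[R]_(m, n)) : \bar R :=
  ereal_inf [set primal f g A x | x in setT].

Definition primal_sol (R : realType) (n m : nat) (f : 'cV[R]_n -> \bar R)
    (g : 'cV[R]_m -> \bar R) (A : 'M[R]_(m, n)) : set 'cV[R]_n :=
  argmin setT (primal f g A).

(* xhat k and ystar k stand for the solutions of the two smoothed subproblems.
   Since tau 0 = 1, the values xbar 0 and ybar 0 have weight 0; they, as well as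
   xhat 0, gamma 0 and beta 0, are left unconstrained. *)
Record ADSGARD (R : realType) (n m : nat) (f : 'cV[R]_n -> \bar R)
    (g : 'cV[R]_m -> \bar R) (A : 'M[R]_(m, n))
    (nrmX : 'cV[R]_n -> R) (nrmY : 'cV[R]_m -> R)
    (bX : 'cV[R]_n -> 'cV[R]_n -> \bar R) (bY : 'cV[R]_m -> 'cV[R]_m -> \bar R)
    (LbX gamma1 : R) (xdot : 'cV[R]_n) (ydot : 'cV[R]_m)
    (tau gamma beta : nat -> R)
    (xbar xhat : nat -> 'cV[R]_n) (ybar yhat ystar : nat -> 'cV[R]_m) :
    Prop := Adsgard {
  adsgard_gamma1 : gamma 1%N = gamma1;
  adsgard_beta1 : beta 1%N = opnorm_sq nrmX nrmY A / gamma1;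
  adsgard_tau0 : tau 0%N = 1;
  adsgard_ystar0 : ystar 0%N = ydot;
  adsgard_yhat : forall k,
    yhat k = (1 - tau k) *: ybar k + tau k *: ystar k;
  adsgard_xhat : forall k,
    argmin (closure (dom f))
      (fun x => f x + (dotv (A^T *m yhat k) x)%:E
                + (gamma k.+1)%:E * bX x xdot)%E
      (xhat k.+1);
  adsgard_ybar : forall k,
    argmin setT
      (fun y => conjugate g y
                - (dotv (A *m xhat k.+1) (y - yhat k))%:E
                + (opnorm_sq nrmX nrmY A / (2 * gamma k.+1)
                   * nrmY (y - yhat k) ^+ 2)%:E)%E
      (ybar k.+1);
  adsgard_xbar : forall k,
    xbar k.+1 = (1 - tau k) *: xbar k + tau k *: xhat k.+1;
  adsgard_ystar : forall k,
    argmax (closure (dom (conjugate g)))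
      (fun y => (dotv (A *m xbar k.+1) y)%:E - conjugate g y
                - (beta k.+1)%:E * bY y ydot)%E
      (ystar k.+1);
  adsgard_tau : forall k,
    0 < tau k.+1 < 1 /\
    tau k.+1 ^+ 3 / LbX + tau k.+1 ^+ 2 + tau k ^+ 2 * tau k.+1
      - tau k ^+ 2 = 0;
  adsgard_gamma : forall k,
    gamma k.+2 = gamma k.+1 / (1 + LbX^-1 * tau k.+1);
  adsgard_beta : forall k, beta k.+2 = (1 - tau k.+1) * beta k.+1
}.

(* Main.v *)
Require Import Defs.
From mathcomp Require Import all_boot all_order all_algebra.
From mathcomp Require Import all_classical all_reals all_analysis.
From mathcomp Require Import ring lra.

Set Implicit Arguments.
Unset Strict Implicit.
Unset Printing Implicit Defensive.

Import Order.TTheory GRing.Theory Num.Theory.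
Import numFieldNormedType.Exports.

Local Open Scope classical_set_scope.
Local Open Scope ring_scope.

(** Write [h] for the conjugate of [g]. Everything follows from one invariant,
    the nonpositivity of a smoothed duality gap: for every [k >= 1], every [x] in
    the domain of [f] and every [y] in the domain of [h],
      f(xbar_k) + <A xbar_k, y> - h(y) - beta_k b_Y(y, ydot)
        <= f(x) + <ybar_k, A x> + gamma_k b_X(x, xdot) - h(ybar_k).
    The supremum of the left-hand side over [y] is the primal objective with [g]
    smoothed by [beta_k b_Y], and the infimum of the right-hand side over [x] is
    the dual objective smoothed by [gamma_k b_X]; keeping [x] and [y] free avoids
    talking about these two extremal values.

    From the invariant to the theorem: choose for [y] a subgradient of [g] at
    [A xbar_k], so that <A xbar_k, y> - h(y) is exactly g(A xbar_k), take the
    solution [xstar] for [x], and bound <ybar_k, A xstar> - h(ybar_k) by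
    g(A xstar) (Fenchel-Young). This gives
      P(xbar_k) - P* <= gamma_k b_X(xstar, xdot) + beta_k D_Y.
    Subgradients exist because [g] is finite and convex: a subgradient is built
    one coordinate at a time, as in the Hahn-Banach theorem
    ([subgradient_partial]).

    The invariant ([gap_estimate]) is propagated by induction. Strong convexity
    of the subproblem defining ystar_k makes the old gap negative by a quadratic
    in y - ystar_k. Combining the old gap with weight 1 - tau_k and the new point
    with weight tau_k, and putting z = (1 - tau_k) ybar_k + tau_k y, one has
    z - yhat_k = tau_k (y - ystar_k); the identity
    beta_{k+1} gamma_{k+1} = LA tau_k^2 turns that quadratic into exactly the
    proximal term LA / (2 gamma_{k+1}) |z - yhat_k|^2 of the step that defines
    ybar_{k+1}. The minimality of ybar_{k+1} and the descent inequality of the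
    smoothed dual function close the induction. The change of the smoothness
    parameter, gamma_k = (1 + tau_k) gamma_{k+1}, costs a multiple of
    b_X(xhat_{k+1}, xdot) that is absorbed because its total coefficient is
    - tau_k^2 gamma_{k+1}.

    The rates come from tau_k >= 1 / (k + 1) ([tau_lower_bound]), by telescoping
    the products that define gamma_k and beta_k.

    Finally D_Y is finite: a Lipschitz [g] has a conjugate with bounded domain,
    and the Lipschitz gradient bounds b_Y(y, ydot) by LbY |y - ydot|^2. *)

(** * Dot product, weighted norms and their duals *)

Lemma dotvE (R : realType) (n : nat) (u v : 'cV[R]_n) :
  dotv u v = (u^T *m v) 0 0.
Proof. by rewrite mxE; apply: eq_bigr => i _; rewrite mxE. Qed.

Lemma dotvC (R : realType) (n : nat) (u v : 'cV[R]_n) : dotv u v = dotv v u.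
Proof. by apply: eq_bigr => i _; rewrite mulrC. Qed.

Lemma dotvDr (R : realType) (n : nat) (u v w : 'cV[R]_n) :
  dotv u (v + w) = dotv u v + dotv u w.
Proof. by rewrite !dotvE mulmxDr mxE. Qed.

Lemma dotvZr (R : realType) (n : nat) (a : R) (u v : 'cV[R]_n) :
  dotv u (a *: v) = a * dotv u v.
Proof. by rewrite !dotvE -scalemxAr mxE. Qed.

Lemma dotvNr (R : realType) (n : nat) (u v : 'cV[R]_n) :
  dotv u (- v) = - dotv u v.
Proof. by rewrite -scaleN1r dotvZr mulN1r. Qed.

Lemma dotvBr (R : realType) (n : nat) (u v w : 'cV[R]_n) :
  dotv u (v - w) = dotv u v - dotv u w.
Proof. by rewrite dotvDr dotvNr. Qed.

Lemma dotvDl (R : realType) (n : nat) (u v w : 'cV[R]_n) :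
  dotv (v + w) u = dotv v u + dotv w u.
Proof. by rewrite dotvC dotvDr !(dotvC u). Qed.

Lemma dotvZl (R : realType) (n : nat) (a : R) (u v : 'cV[R]_n) :
  dotv (a *: v) u = a * dotv v u.
Proof. by rewrite dotvC dotvZr (dotvC u). Qed.

Lemma dotvNl (R : realType) (n : nat) (u v : 'cV[R]_n) :
  dotv (- v) u = - dotv v u.
Proof. by rewrite dotvC dotvNr (dotvC u). Qed.

Lemma dotvBl (R : realType) (n : nat) (u v w : 'cV[R]_n) :
  dotv (v - w) u = dotv v u - dotv w u.
Proof. by rewrite dotvDl dotvNl. Qed.

Lemma dotv0r (R : realType) (n : nat) (u : 'cV[R]_n) : dotv u 0 = 0.
Proof. by rewrite dotvE mulmx0 mxE. Qed.

Lemma dotv_trmx (R : realType) (n m : nat) (A : 'M[R]_(m, n))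
    (u : 'cV[R]_m) (v : 'cV[R]_n) :
  dotv (A^T *m u) v = dotv u (A *m v).
Proof. by rewrite !dotvE trmx_mul trmxK mulmxA. Qed.

Lemma dotvv_ge0 (R : realType) (n : nat) (u : 'cV[R]_n) : 0 <= dotv u u.
Proof. by apply: sumr_ge0 => i _; rewrite -expr2 sqr_ge0. Qed.

Lemma dotvv_eq0 (R : realType) (n : nat) (u : 'cV[R]_n) :
  (dotv u u == 0) = (u == 0).
Proof.
apply/eqP/eqP => [h|->]; last by rewrite dotv0r.
apply/colP => i; rewrite mxE; apply/eqP; rewrite -sqrf_eq0 expr2.
move/eqP: h; rewrite psumr_eq0 => [/allP/(_ i)|j _]; last by rewrite -expr2 sqr_ge0.
by rewrite mem_index_enum => /(_ isT).
Qed.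

Lemma dotv_cauchy_schwarz (R : realType) (n : nat) (u v : 'cV[R]_n) :
  dotv u v ^+ 2 <= dotv u u * dotv v v.
Proof.
have [->|v0] := eqVneq v 0; first by rewrite !dotv0r expr0n mulr0.
have vv : 0 < dotv v v by rewrite lt_def dotvv_eq0 v0 dotvv_ge0.
have := dotvv_ge0 (dotv v v *: u - dotv u v *: v).
rewrite !(dotvBr, dotvBl, dotvZr, dotvZl) (dotvC v u).
set a := dotv u u; set b := dotv v v in vv *; set c := dotv u v => h.
rewrite -(ler_pM2l vv) -subr_ge0; apply: le_trans h _; lra.
Qed.

Lemma wnorm_ge0 (R : realType) (q n : nat) (S : 'M[R]_(q, n)) (z : 'cV[R]_n) :
  0 <= wnorm S z.
Proof. exact: sqrtr_ge0. Qed.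

Lemma wnorm_sqr (R : realType) (q n : nat) (S : 'M[R]_(q, n)) (z : 'cV[R]_n) :
  wnorm S z ^+ 2 = dotv (S *m z) (S *m z).
Proof. by rewrite sqr_sqrtr ?dotvv_ge0. Qed.

Lemma wnormZ_sqr (R : realType) (q n : nat) (S : 'M[R]_(q, n)) (a : R)
    (z : 'cV[R]_n) : wnorm S (a *: z) ^+ 2 = a ^+ 2 * wnorm S z ^+ 2.
Proof. by rewrite !wnorm_sqr -scalemxAr dotvZr dotvZl mulrA expr2. Qed.

Lemma wnormZ (R : realType) (q n : nat) (S : 'M[R]_(q, n)) (a : R)
    (z : 'cV[R]_n) : wnorm S (a *: z) = `|a| * wnorm S z.
Proof.
by rewrite /wnorm -scalemxAr dotvZr dotvZl mulrA -expr2 sqrtrM ?sqr_ge0 // sqrtr_sqr.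
Qed.

Lemma wnormN (R : realType) (q n : nat) (S : 'M[R]_(q, n)) (z : 'cV[R]_n) :
  wnorm S (- z) = wnorm S z.
Proof. by rewrite -scaleN1r wnormZ normrN1 mul1r. Qed.

Lemma wnorm0 (R : realType) (q n : nat) (S : 'M[R]_(q, n)) :
  wnorm S 0 = 0.
Proof. by rewrite /wnorm mulmx0 dotv0r sqrtr0. Qed.

Lemma wnorm_gt0 (R : realType) (q n : nat) (S : 'M[R]_(q, n)) (z : 'cV[R]_n) :
  posdef (S^T *m S) -> z != 0 -> 0 < wnorm S z.
Proof.
by move=> hS z0; rewrite sqrtr_gt0 -dotv_trmx dotvC mulmxA; exact: hS.
Qed.

Lemma posdef_unitmx (R : realType) (n : nat) (M : 'M[R]_n) :
  posdef M -> M \in unitmx.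
Proof.
move=> hM; rewrite -unitmx_tr -row_free_unit -kermx_eq0.
apply/eqP/row_matrixP => i; rewrite row0; apply/eqP/negPn/negP => u0.
set u := row i _ in u0.
have uM : u *m M^T = 0.
  by apply/sub_kermxP; rewrite /u row_sub.
have : u^T != 0 by apply: contra u0 => /eqP/(congr1 trmx); rewrite trmxK trmx0 => ->.
move=> /hM; rewrite -[M *m _]trmxK trmx_mul trmxK uM trmx0 dotv0r.
by rewrite ltxx.
Qed.

(** The vector [S (S^T S)^-1 u] is a preimage of [u] under [S^T], so [dotv u v]
    is its dot product with [S v] and the Cauchy-Schwarz inequality applies. This
    is what makes the suprema defining [dual_norm] and [opnorm_sq] finite. *)
Lemma dotv_sqr_le_wnorm (R : realType) (q n : nat) (S : 'M[R]_(q, n))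
    (u : 'cV[R]_n) : posdef (S^T *m S) ->
  forall v, dotv u v ^+ 2 <=
    dotv (S *m (invmx (S^T *m S) *m u)) (S *m (invmx (S^T *m S) *m u))
    * wnorm S v ^+ 2.
Proof.
move=> hS v; rewrite wnorm_sqr.
have -> : dotv u v = dotv (S *m (invmx (S^T *m S) *m u)) (S *m v).
  by rewrite -dotv_trmx !mulmxA mulmxV ?posdef_unitmx // mul1mx.
exact: dotv_cauchy_schwarz.
Qed.

Lemma dual_norm_has_ubound (R : realType) (q n : nat) (S : 'M[R]_(q, n))
    (u : 'cV[R]_n) : posdef (S^T *m S) ->
  has_ubound [set dotv u v | v in [set v | wnorm S v = 1]].
Proof.
move=> hS; eexists => _ [v /= v1 <-].
apply: le_trans (ler_norm _) _; rewrite -sqrtr_sqr; apply: ler_wsqrtr.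
have := dotv_sqr_le_wnorm u hS v.
by rewrite v1 expr1n mulr1; apply.
Qed.

Lemma dotv_le_dual_norm (R : realType) (q n : nat) (S : 'M[R]_(q, n))
    (u v : 'cV[R]_n) : posdef (S^T *m S) ->
  dotv u v <= dual_norm (wnorm S) u * wnorm S v.
Proof.
move=> hS; have [->|v0] := eqVneq v 0; first by rewrite dotv0r wnorm0 mulr0.
have Nv := wnorm_gt0 hS v0.
rewrite -ler_pdivrMr //; apply: ub_le_sup; first exact: dual_norm_has_ubound.
exists ((wnorm S v)^-1 *: v); last by rewrite dotvZr mulrC.
by rewrite /= wnormZ ger0_norm ?invr_ge0 ?wnorm_ge0 // mulVf ?gt_eqF.
Qed.

Lemma dual_norm_sqr_le (R : realType) (q n : nat) (S : 'M[R]_(q, n))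
    (u : 'cV[R]_n) : posdef (S^T *m S) ->
  dual_norm (wnorm S) u ^+ 2 <=
    dotv (S *m (invmx (S^T *m S) *m u)) (S *m (invmx (S^T *m S) *m u)).
Proof.
move=> hS; set r := dotv (S *m _) _.
have r0 : 0 <= r by exact: dotvv_ge0.
rewrite /dual_norm; set E := image _ _.
have [->|/set0P[_ [v /= v1 _]]] := eqVneq E set0.
  by rewrite sup0 expr0n.
rewrite -(sqr_sqrtr r0) ler_pXn2r ?nnegrE ?sqrtr_ge0 //.
- apply: ge_sup; first by exists (dotv u v), v.
  move=> _ [w /= w1 <-].
  apply: le_trans (ler_norm _) _; rewrite -sqrtr_sqr; apply: ler_wsqrtr.
  by have := dotv_sqr_le_wnorm u hS w; rewrite w1 expr1n mulr1.
- have ub := dual_norm_has_ubound u hS.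
  have h1 : dotv u v <= sup E by apply: ub_le_sup => //; exists v.
  have h2 : dotv u (- v) <= sup E.
    by apply: ub_le_sup => //; exists (- v) => //=; rewrite wnormN.
  by move: h2; rewrite dotvNr; lra.
Qed.

(** The dual norm of [A x] is at most the Euclidean norm of [B x] for a matrix
    [B]; each row of [B] is a linear form, bounded in the norm of [x]. *)
Lemma opnorm_sq_has_ubound (R : realType) (n m qX qY : nat)
    (A : 'M[R]_(m, n)) (SX : 'M[R]_(qX, n)) (SY : 'M[R]_(qY, m)) :
  posdef (SX^T *m SX) -> posdef (SY^T *m SY) ->
  has_ubound [set dual_norm (wnorm SY) (A *m x) ^+ 2 / wnorm SX x ^+ 2 |
              x in [set x | x != 0]].
Proof.
move=> hX hY; pose B := SY *m invmx (SY^T *m SY) *m A.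
pose c i := dotv (SX *m (invmx (SX^T *m SX) *m (row i B)^T))
                 (SX *m (invmx (SX^T *m SX) *m (row i B)^T)).
exists (\sum_i c i) => _ [x /= x0 <-].
have Nx : 0 < wnorm SX x ^+ 2 by rewrite exprn_gt0 ?wnorm_gt0.
rewrite ler_pdivrMr //; apply: le_trans (dual_norm_sqr_le _ hY) _.
rewrite !mulmxA -/B mulr_suml; apply: ler_sum => i _.
rewrite -expr2; have := dotv_sqr_le_wnorm (row i B)^T hX x.
by rewrite dotvE trmxK -row_mul mxE.
Qed.

Lemma opnorm_sq_ge0 (R : realType) (n m : nat) (A : 'M[R]_(m, n))
    (nX : 'cV[R]_n -> R) (nY : 'cV[R]_m -> R) : 0 <= opnorm_sq nX nY A.
Proof.
rewrite /opnorm_sq; set E := image _ _.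
have [hE|/sup_out ->//] := pselect (has_sup E).
have [r Er] := hE.1; apply: le_trans (sup_upper_bound hE Er).
by case: Er => x _ <-; rewrite divr_ge0 ?sqr_ge0.
Qed.

(** The product of the norms of [x] and [y] that bounds the pairing is split by
    the inequality between arithmetic and geometric means. The weight [c] will be
    the smoothness parameter: the first term is then paid by strong convexity and
    the second one is the proximal term of the dual step. *)
Lemma dotv_mulmx_le (R : realType) (n m qX qY : nat)
    (A : 'M[R]_(m, n)) (SX : 'M[R]_(qX, n)) (SY : 'M[R]_(qY, m))
    (c : R) (x : 'cV[R]_n) (y : 'cV[R]_m) :
  posdef (SX^T *m SX) -> posdef (SY^T *m SY) -> 0 < c ->
  dotv (A *m x) y <= c / 2 * wnorm SX x ^+ 2 +
    opnorm_sq (wnorm SX) (wnorm SY) A / (2 * c) * wnorm SY y ^+ 2.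
Proof.
move=> hX hY c0; set LA := opnorm_sq _ _ _.
have LA0 : 0 <= LA by exact: opnorm_sq_ge0.
set d := dual_norm (wnorm SY) (A *m x).
have dle : d ^+ 2 <= LA * wnorm SX x ^+ 2.
  have [x0|x0] := eqVneq x 0.
    rewrite /d x0 mulmx0 wnorm0 expr0n mulr0.
    apply: le_trans (dual_norm_sqr_le _ hY) _.
    by rewrite !mulmx0 dotv0r.
  rewrite -ler_pdivrMr ?exprn_gt0 ?wnorm_gt0 //.
  by apply: ub_le_sup; [exact: opnorm_sq_has_ubound|exists x].
apply: le_trans (dotv_le_dual_norm _ _ hY) _; rewrite -/d.
have s2 := sqr_sqrtr LA0; set s := Num.sqrt LA in s2.
have s0 : 0 <= s by exact: sqrtr_ge0.
have X0 := wnorm_ge0 SX x; have Y0 := wnorm_ge0 SY y.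
set X := wnorm SX x in dle X0 *; set Y := wnorm SY y in Y0 *.
have dX : d <= s * X.
  apply: le_trans (ler_norm _) _; rewrite -sqrtr_sqr.
  rewrite -(ger0_norm (mulr_ge0 s0 X0)) -sqrtr_sqr exprMn s2.
  exact: ler_wsqrtr.
apply: le_trans (ler_wpM2r Y0 dX) _; rewrite -s2 -subr_ge0.
have -> : c / 2 * X ^+ 2 + s ^+ 2 / (2 * c) * Y ^+ 2 - s * X * Y =
    (c * X - s * Y) ^+ 2 / (2 * c) by field; lra.
by rewrite divr_ge0 ?sqr_ge0 //; lra.
Qed.

Lemma wnorm_sqr_le (R : realType) (q n : nat) (S : 'M[R]_(q, n))
    (z b : 'cV[R]_n) : (forall j, `|z j 0| <= b j 0) ->
  wnorm S z ^+ 2 <= \sum_i (\sum_j `|S i j| * b j 0) ^+ 2.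
Proof.
move=> zb; rewrite wnorm_sqr; apply: ler_sum => i _; rewrite -expr2.
rewrite -real_normK ?num_real // ler_pXn2r ?nnegrE //; last first.
  by apply: sumr_ge0 => j _; rewrite mulr_ge0 // (le_trans _ (zb j)).
rewrite mxE; apply: le_trans (ler_norm_sum _ _ _) _; apply: ler_sum => j _.
by rewrite normrM ler_wpM2l.
Qed.

(** * Strong convexity and Bregman distances of real functions *)

(** The set [C] is required to be convex as well, so that the effective domain
    of an extended-valued function can play its role; [mu = 0] is plain
    convexity. *)
Definition strongly_convex_on (R : realType) (n : nat) (C : set 'cV[R]_n)
    (nrm : 'cV[R]_n -> R) (mu : R) (F : 'cV[R]_n -> R) : Prop :=
  forall (x y : 'cV[R]_n) (t : R), C x -> C y -> 0 < t < 1 ->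
    C (t *: x + (1 - t) *: y) /\
    F (t *: x + (1 - t) *: y) + mu / 2 * t * (1 - t) * nrm (x - y) ^+ 2
      <= t * F x + (1 - t) * F y.

Lemma strongly_convex_onD (R : realType) (n : nat) (C : set 'cV[R]_n)
    (nrm : 'cV[R]_n -> R) (mu nu : R) (F G : 'cV[R]_n -> R) :
  strongly_convex_on C nrm mu F -> strongly_convex_on C nrm nu G ->
  strongly_convex_on C nrm (mu + nu) (fun x => F x + G x).
Proof.
move=> hF hG x y t Cx Cy t01; have [Cz h1] := hF x y t Cx Cy t01.
by have [_ h2] := hG x y t Cx Cy t01; split => //; lra.
Qed.

Lemma strongly_convex_onZ (R : realType) (n : nat) (C : set 'cV[R]_n)
    (nrm : 'cV[R]_n -> R) (mu c : R) (F : 'cV[R]_n -> R) :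
  0 <= c -> strongly_convex_on C nrm mu F ->
  strongly_convex_on C nrm (c * mu) (fun x => c * F x).
Proof.
move=> c0 hF x y t Cx Cy t01; have [Cz h1] := hF x y t Cx Cy t01.
by split => //; have := ler_wpM2l c0 h1; lra.
Qed.

Lemma strongly_convex_on_linear (R : realType) (n : nat) (C : set 'cV[R]_n)
    (nrm : 'cV[R]_n -> R) (mu : R) (F : 'cV[R]_n -> R) (u : 'cV[R]_n) :
  strongly_convex_on C nrm mu F ->
  strongly_convex_on C nrm mu (fun x => F x + dotv u x).
Proof.
move=> hF x y t Cx Cy t01; have [Cz h1] := hF x y t Cx Cy t01.
by split => //; rewrite dotvDr !dotvZr; lra.
Qed.

Lemma ler_of_onem_mul (R : realType) (c d : R) :
  (forall t, 0 < t < 1 -> (1 - t) * c <= d) -> c <= d.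
Proof.
move=> h; rewrite leNgt; apply/negP => dc.
have hd : c <= 2 * d by have := h (1 / 2) ltac:(lra); lra.
have c0 : 0 < c by lra.
have t01 : 0 < (c - d) / (2 * c) < 1.
  by rewrite divr_gt0 ?ltr_pdivrMr /=; lra.
have := h _ t01.
have -> : (1 - (c - d) / (2 * c)) * c = (c + d) / 2 by field; lra.
lra.
Qed.

(** The minimal value is compared with the values on the segment from [z] towards
    [w]; dividing by the length of the segment and letting it shrink recovers the
    whole modulus of convexity. *)
Lemma min_quadratic_growth (R : realType) (n : nat) (C : set 'cV[R]_n)
    (nrm : 'cV[R]_n -> R) (mu : R) (F : 'cV[R]_n -> R) (z : 'cV[R]_n) :
  strongly_convex_on C nrm mu F -> C z -> (forall w, C w -> F z <= F w) ->
  forall w, C w -> F z + mu / 2 * nrm (w - z) ^+ 2 <= F w.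
Proof.
move=> hF Cz zmin w Cw; rewrite -lerBrDl; apply: ler_of_onem_mul => t t01.
have [Cv h] := hF w z t Cw Cz t01.
have t0 : 0 < t by lra.
by rewrite -(ler_pM2l t0); have := zmin _ Cv; lra.
Qed.

(** The gradient is only a derivative relative to [D], and [z] may lie on the
    boundary of [D]. This is enough, because the segment from [z] to [w] stays in
    [D] and the inequality only needs the slope of [p] along it. *)
Lemma bregman_lower_bound (R : realType) (n : nat) (D : set 'cV[R]_n)
    (nrm : 'cV[R]_n -> R) (p : 'cV[R]_n -> R) (dp : 'cV[R]_n -> 'cV[R]_n) :
  nrm 0 = 0 ->
  strongly_convex_on D nrm 1 p -> gradient_on D p dp ->
  forall z w, D z -> D w ->
    1 / 2 * nrm (w - z) ^+ 2 <= p w - p z - dotv (dp z) (w - z).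
Proof.
move=> nrm0 hp hg z w Dz Dw.
have [->|wz] := eqVneq w z; first by rewrite !subrr nrm0 dotv0r expr0n mulr0 subr0.
have d0 : 0 < `|w - z| by rewrite normr_gt0 subr_eq0.
set T := dotv _ _; set N := nrm _ ^+ 2.
apply/ler_addgt0Pr => e e0; apply: ler_of_onem_mul => s s01.
(* e / |w - z| is the accuracy that yields e after scaling to the segment *)
have /cvgrPdist_lt/(_ _ (divr_gt0 e0 d0)) := hg z Dz.
rewrite near_withinE => /nbhs_normP[r /= r0 hr].
pose t := Num.min s (r / (2 * `|w - z|)).
have t0 : 0 < t.
  by rewrite lt_min divr_gt0 ?mulr_gt0 // andbT; lra.
have ts : t <= s by rewrite ge_min lexx.
have tr : t * `|w - z| < r.
  apply: (@le_lt_trans _ _ (r / (2 * `|w - z|) * `|w - z|)).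
    by rewrite ler_pM2r // ge_min lexx orbT.
  by rewrite invfM mulrA divfK ?gt_eqF //; lra.
have t01 : 0 < t < 1 by lra.
have [Dv h] := hp w z t Dw Dz t01.
have vz : t *: w + (1 - t) *: z - z = t *: (w - z).
  by apply/colP => i; rewrite !mxE; lra.
have := hr (t *: w + (1 - t) *: z).
rewrite /= (distrC z) -(subr_eq0 _ z) vz normrZ gtr0_norm // scaler_eq0 subr_eq0.
rewrite (negbTE wz) gt_eqF //= => /(_ tr isT Dv).
rewrite dotvZr -/T sub0r normrN.
rewrite ltr_norml => /andP[+ _].
rewrite ltr_pdivlMr ?mulr_gt0 // => h1.
have h2 : - (e / `|w - z|) * (t * `|w - z|) = - (e * t).
  by field; rewrite gt_eqF.
rewrite h2 in h1; have N0 : 0 <= N by exact: sqr_ge0.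
rewrite -/N in h; rewrite -(ler_pM2l t0).
have := ler_wpM2l (mulr_ge0 (ltW t0) N0) ts; lra.
Qed.

(** * Subgradients of finite convex functions *)

(** Each step of the induction extends a subgradient for the directions
    supported on the first [j] coordinates to one more coordinate [e]. Its new
    component must exceed all difference quotients along [- e] and be exceeded by
    all those along [e]; by convexity the former are below the latter, and their
    supremum is chosen. *)
Lemma subgradient_partial (R : realType) (m : nat) (g : 'cV[R]_m -> R)
    (u : 'cV[R]_m) :
  (forall x y t, 0 < t < 1 ->
     g (t *: x + (1 - t) *: y) <= t * g x + (1 - t) * g y) ->
  forall j, (j <= m)%N ->
  exists y : 'cV[R]_m, forall v : 'cV[R]_m,
    (forall i : 'I_m, (j <= i)%N -> v i 0 = 0) ->
    g u + dotv y v <= g (u + v).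
Proof.
move=> gcvx; elim=> [_|j IH jm].
  exists 0 => v v0; have -> : v = 0 by apply/colP => i; rewrite v0 // mxE.
  by rewrite dotv0r !addr0.
have [y hy] := IH (ltnW jm).
pose i0 := Ordinal jm; pose e : 'cV[R]_m := delta_mx i0 0.
pose V := [set v : 'cV[R]_m | forall i : 'I_m, (j <= i)%N -> v i 0 = 0].
pose lo := [set (g u + dotv y p.1 - g (u + p.1 - p.2 *: e)) / p.2 |
            p in [set p : 'cV[R]_m * R | V p.1 /\ 0 < p.2]].
have V0 : V 0 by move=> i _; rewrite mxE.
have lo0 : lo !=set0.
  by eexists; exists (0, 1); [split => //=; exact: ltr01|reflexivity].
have up w s : V w -> 0 < s ->
    ubound lo ((g (u + w + s *: e) - g u - dotv y w) / s).
  move=> Vw s0 _ [[v r] /= [Vv r0] <-].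
  rewrite ler_pdivrMr // mulrAC ler_pdivlMr //.
  (* the weights s/(r+s) and r/(r+s) cancel the two multiples of e *)
  pose t := s / (r + s).
  have rs : 0 < r + s by lra.
  have t01 : 0 < t < 1 by rewrite divr_gt0 // ltr_pdivrMr //; lra.
  have Vz : V (t *: v + (1 - t) *: w).
    by move=> i ji; rewrite !mxE Vv // Vw // !mulr0 addr0.
  have tr : t * r = (1 - t) * s by rewrite /t; field; lra.
  have zE : t *: (u + v - r *: e) + (1 - t) *: (u + w + s *: e) =
            u + (t *: v + (1 - t) *: w).
    apply/colP => i; have := congr1 ( *%R^~ (e i 0)) tr; rewrite !mxE /=; lra.
  have := gcvx (u + v - r *: e) (u + w + s *: e) t t01; rewrite zE => h1.
  have h2 := hy _ Vz; rewrite dotvDr !dotvZr in h2.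
  have := ler_wpM2l (ltW rs) (le_trans h2 h1).
  have -> : (r + s) * (g u + (t * dotv y v + (1 - t) * dotv y w)) =
      (r + s) * g u + s * dotv y v + r * dotv y w by rewrite /t; field; lra.
  have -> : forall a b, (r + s) * (t * a + (1 - t) * b) = s * a + r * b.
    by move=> a b; rewrite /t; field; lra.
  by lra.
have supE w s : V w -> 0 < s ->
    sup lo <= (g (u + w + s *: e) - g u - dotv y w) / s.
  by move=> Vw s0; apply: ge_sup => //; exact: up.
have leE v s : V v -> 0 < s ->
    (g u + dotv y v - g (u + v - s *: e)) / s <= sup lo.
  move=> Vv s0; apply: ub_le_sup; last by exists (v, s).
  by eexists; apply: (up 0 1 V0); exact: ltr01.
exists (y + (sup lo - y i0 0) *: e) => v hv.
pose s := v i0 0; pose w := v - s *: e.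
have Vw : V w.
  move=> i ji; rewrite !mxE eqxx andbT.
  have [->|ii0] := eqVneq i i0; first by rewrite /s mulr1 subrr.
  rewrite mulr0 subr0; apply: hv; rewrite ltn_neqAle ji andbT.
  by apply: contra ii0 => /eqP ij; apply/eqP/val_inj.
have ee x : dotv e x = x i0 0.
  by rewrite dotvE trmx_delta -rowE mxE.
have vE : v = w + s *: e by rewrite subrK.
have -> : dotv (y + (sup lo - y i0 0) *: e) v = dotv y w + s * sup lo.
  rewrite dotvDl dotvZl ee -/s {1}vE dotvDr dotvZr (dotvC y e) ee; ring.
have uE : u + w + s *: e = u + v by rewrite -addrA -vE.
have [s0|s0|s0] := ltgtP 0 s.
- by have := supE w s Vw s0; rewrite ler_pdivlMr // uE; lra.
- have ns0 : 0 < - s by lra.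
  by have := leE w (- s) Vw ns0; rewrite ler_pdivrMr // scaleNr opprK uE; lra.
- by rewrite -s0 mul0r addr0; have := hy w Vw; rewrite vE -s0 scale0r addr0.
Qed.

Lemma subgradient_exists (R : realType) (m : nat) (g : 'cV[R]_m -> R) :
  (forall x y t, 0 < t < 1 ->
     g (t *: x + (1 - t) *: y) <= t * g x + (1 - t) * g y) ->
  forall u, exists y, forall v, g u + dotv y (v - u) <= g v.
Proof.
move=> gcvx u; have [y hy] := subgradient_partial u gcvx (leqnn m).
exists y => v; rewrite -[in leRHS](subrK u v) [_ - _ + _]addrC; apply: hy => i.
by rewrite leqNgt ltn_ord.
Qed.

(** * The parameter sequences *)

(** With [a = tau k.+1] and [b = tau k], the left-hand side of the recursion
    increases with [a] and the right-hand side decreases. If [b >= 1 / (k + 1)],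
    a value [a < 1 / (k + 2)] would make the left-hand side too small, because
    [(k + 1) (k + 3) < (k + 2) ^ 2]. *)
Lemma tau_lower_bound (R : realType) (tau : nat -> R) :
  tau 0%N = 1 -> (forall k, 0 < tau k.+1 < 1) ->
  (forall k, tau k.+1 ^+ 2 * (1 + tau k.+1) = tau k ^+ 2 * (1 - tau k.+1)) ->
  forall k, 1 <= tau k * (k%:R + 1).
Proof.
move=> t0 t01 trec; elim=> [|k IH]; first by rewrite t0 add0r mulr1.
have /andP[a0 a1] := t01 k; have := trec k.
set a := tau k.+1 in a0 a1 *; set b := tau k in IH * => E.
rewrite -natr1 -addrA; have K0 : (0 : R) <= k%:R by exact: ler0n.
rewrite leNgt; apply/negP => lt1.
(* with c = k + 2 and d = a c < 1, the recursion multiplied by c ^ 3 leads to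
   c ^ 2 (c - 1) < (c + 1) (c - 1) ^ 2, that is c ^ 2 < c ^ 2 - 1 *)
have [c cE] : {c : R | c = k%:R + (1 + 1)} by exists (k%:R + (1 + 1)).
rewrite -cE in lt1; have kE : k%:R + 1 = c - 1 by rewrite cE; lra.
rewrite kE in IH; have c2 : 2 <= c by rewrite cE; lra.
have b2 : 1 <= (b * (c - 1)) ^+ 2 by rewrite exprn_ege1.
have h1 : 1 - a <= a ^+ 2 * (1 + a) * (c - 1) ^+ 2.
  rewrite E; have a1' : 0 <= 1 - a by lra.
  by have := ler_wpM2r a1' b2; lra.
have [d dE] : {d : R | d = a * c} by exists (a * c).
rewrite -dE in lt1.
have d0 : 0 < d by rewrite dE mulr_gt0 //; lra.
have d2 : d ^+ 2 <= 1 by rewrite exprn_ile1 // ltW.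
have h2 : d ^+ 2 * (c + d) <= c + 1.
  have cd : 0 <= c + d by lra.
  by have := ler_wpM2r cd d2; lra.
have c1 : 0 < (c - 1) ^+ 2 by rewrite exprn_gt0 //; lra.
have h3 := ler_wpM2r (ltW c1) h2.
have c3 : 0 <= c ^+ 3 by rewrite exprn_ge0 //; lra.
have h4 := ler_wpM2l c3 h1.
have c22 : 0 < c ^+ 2 by rewrite exprn_gt0 //; lra.
have h5 : c ^+ 2 * (c - 1) < c ^+ 3 * (1 - a).
  have -> : c ^+ 3 * (1 - a) = c ^+ 2 * (c - d) by rewrite dE; ring.
  by rewrite ltr_pM2l //; lra.
have h6 : c ^+ 3 * (a ^+ 2 * (1 + a) * (c - 1) ^+ 2) =
  d ^+ 2 * (c + d) * (c - 1) ^+ 2 by rewrite dE; ring.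
rewrite h6 in h4.
have : c ^+ 2 * (c - 1) < (c + 1) * (c - 1) ^+ 2.
  exact: lt_le_trans h5 (le_trans h4 h3).
have -> : (c + 1) * (c - 1) ^+ 2 = (c ^+ 2 - 1) * (c - 1) by ring.
by rewrite ltr_pM2r; lra.
Qed.

(** By [tau_lower_bound], passing from [k] to [k.+1] divides [gamma] by at least
    [(k + 3) / (k + 2)], and these quotients telescope. *)
Lemma gamma_bounds (R : realType) (tau gamma : nat -> R) (gamma1 : R) :
  0 < gamma1 -> gamma 1%N = gamma1 -> (forall k, 0 < tau k.+1) ->
  (forall k, 1 <= tau k * (k%:R + 1)) ->
  (forall k, gamma k.+2 = gamma k.+1 / (1 + tau k.+1)) ->
  forall k, 0 < gamma k.+1 <= 2 * gamma1 / (k%:R + 2).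
Proof.
move=> g0 g1 t0 tlow grec; elim=> [|k /andP[p le]].
  by rewrite g1 g0 /= add0r mulrAC divff ?mul1r // pnatr_eq0.
have := tlow k.+1; rewrite grec; have := t0 k.
set a := tau k.+1; rewrite -natr1 => a0 alow.
have K0 : (0 : R) <= k%:R by exact: ler0n.
rewrite divr_gt0 //=; last by lra.
rewrite ler_pdivrMr; last by lra.
apply: (le_trans le); rewrite [leRHS]mulrAC ler_pdivlMr; last by lra.
rewrite [leLHS]mulrAC ler_pdivrMr; last by lra.
by rewrite -!mulrA ler_pM2l // ler_pM2l //; lra.
Qed.

(** Here the telescoping factor is [1 - tau k.+1 <= (k + 1) / (k + 2)]. *)
Lemma beta_bounds (R : realType) (tau beta : nat -> R) (beta1 : R) :
  0 <= beta1 -> beta 1%N = beta1 -> (forall k, 0 < tau k.+1 < 1) ->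
  (forall k, 1 <= tau k * (k%:R + 1)) ->
  (forall k, beta k.+2 = (1 - tau k.+1) * beta k.+1) ->
  forall k, 0 <= beta k.+1 <= beta1 / (k%:R + 1).
Proof.
move=> b0 b1 t01 tlow brec; elim=> [|k /andP[p le]].
  by rewrite b1 b0 /= add0r divr1.
have := tlow k.+1; rewrite brec; have /andP[] := t01 k.
set a := tau k.+1; rewrite -natr1 => a0 a1 alow.
have K0 : (0 : R) <= k%:R by exact: ler0n.
rewrite mulr_ge0 //=; last by lra.
have a1' : 0 <= 1 - a by lra.
apply: (le_trans (ler_wpM2l a1' le)).
rewrite mulrCA ler_wpM2l // ler_pdivrMr; last by lra.
by rewrite [leRHS]mulrC ler_pdivlMr; lra.
Qed.

(** The cubic equation for [tau k.+1] is exactly the condition under which this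
    coupling of the two smoothness parameters is preserved. *)
Lemma beta_gamma_product (R : realType) (tau gamma beta : nat -> R) (LA gamma1 : R) :
  0 < gamma1 -> gamma 1%N = gamma1 -> beta 1%N = LA / gamma1 ->
  tau 0%N = 1 -> (forall k, 0 < tau k.+1) ->
  (forall k, tau k.+1 ^+ 2 * (1 + tau k.+1) = tau k ^+ 2 * (1 - tau k.+1)) ->
  (forall k, gamma k.+2 = gamma k.+1 / (1 + tau k.+1)) ->
  (forall k, beta k.+2 = (1 - tau k.+1) * beta k.+1) ->
  forall k, beta k.+1 * gamma k.+1 = LA * tau k ^+ 2.
Proof.
move=> g0 g1 b1 t0 tpos trec grec brec; elim=> [|k IH].
  by rewrite g1 b1 t0 expr1n mulr1 divfK ?gt_eqF.
have a0 : 1 + tau k.+1 != 0 by have := tpos k; lra.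
apply: (mulIf a0); rewrite grec brec mulrA divfK // -mulrA IH -mulrA trec.
by ring.
Qed.

(** * The smoothed duality gap *)

(** The algorithm is reduced here to real functions [f], [bx] on [Cf] and [h],
    [b] on [Cg], standing for [f], the primal Bregman distance, the conjugate of
    [g] and the dual Bregman distance on the effective domains. The base case uses
    [tau 0 = 1], which turns the arbitrary initial averages off, together with
    the quadratic lower bound on [b] around [ydot = yhat 0]. *)
Lemma gap_estimate (R : realType) (n m : nat)
    (Cf : set 'cV[R]_n) (Cg : set 'cV[R]_m) (A : 'M[R]_(m, n))
    (f bx : 'cV[R]_n -> R) (h b : 'cV[R]_m -> R)
    (nX : 'cV[R]_n -> R) (nY : 'cV[R]_m -> R) (LA : R) (ydot : 'cV[R]_m)
    (tau gamma beta : nat -> R)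
    (xbar xhat : nat -> 'cV[R]_n) (ybar yhat ystar : nat -> 'cV[R]_m) :
  strongly_convex_on Cf nX 0 f -> strongly_convex_on Cf nX 1 bx ->
  strongly_convex_on Cg nY 0 h -> strongly_convex_on Cg nY 1 b ->
  (forall x, Cf x -> 0 <= bx x) ->
  (forall y, Cg y -> 1 / 2 * nY (y - ydot) ^+ 2 <= b y) ->
  (forall a y, nY (a *: y) ^+ 2 = a ^+ 2 * nY y ^+ 2) ->
  (forall c x y, 0 < c ->
     dotv (A *m x) y <= c / 2 * nX x ^+ 2 + LA / (2 * c) * nY y ^+ 2) ->
  tau 0%N = 1 -> (forall k, 0 < tau k.+1 < 1) ->
  (forall k, 0 < gamma k.+1) -> (forall k, 0 <= beta k.+1) ->
  (forall k, beta k.+1 * gamma k.+1 = LA * tau k ^+ 2) ->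
  (forall k, gamma k.+1 = (1 + tau k.+1) * gamma k.+2) ->
  (forall k, beta k.+2 = (1 - tau k.+1) * beta k.+1) ->
  ystar 0%N = ydot ->
  (forall k, yhat k = (1 - tau k) *: ybar k + tau k *: ystar k) ->
  (forall k, xbar k.+1 = (1 - tau k) *: xbar k + tau k *: xhat k.+1) ->
  (forall k, Cf (xhat k.+1) /\ forall x, Cf x ->
     f (xhat k.+1) + gamma k.+1 * bx (xhat k.+1)
       + dotv (A^T *m yhat k) (xhat k.+1)
     <= f x + gamma k.+1 * bx x + dotv (A^T *m yhat k) x) ->
  (forall k, Cg (ybar k.+1) /\ forall y, Cg y ->
     h (ybar k.+1) - dotv (A *m xhat k.+1) (ybar k.+1 - yhat k)
       + LA / (2 * gamma k.+1) * nY (ybar k.+1 - yhat k) ^+ 2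
     <= h y - dotv (A *m xhat k.+1) (y - yhat k)
       + LA / (2 * gamma k.+1) * nY (y - yhat k) ^+ 2) ->
  (forall k, Cg (ystar k.+1) /\ forall y, Cg y ->
     h (ystar k.+1) + beta k.+1 * b (ystar k.+1)
       + dotv (- (A *m xbar k.+1)) (ystar k.+1)
     <= h y + beta k.+1 * b y + dotv (- (A *m xbar k.+1)) y) ->
  forall k, Cf (xbar k.+1) /\ forall x y, Cf x -> Cg y ->
    f (xbar k.+1) + dotv (A *m xbar k.+1) y - h y - beta k.+1 * b y
    <= f x + dotv (A *m x) (ybar k.+1) + gamma k.+1 * bx x - h (ybar k.+1).
Proof.
move=> cf cbx ch cb bx0 b_lb nYZ pairing t0 t01 gpos bpos bg grec brec ys0
  yhatE xbarE xhatP ybarP ystarP.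
(* The left-hand side is a lower model of the smoothed dual objective at z,
   touching it at z = yhat k; ybar k.+1 maximizes the model, and the model is
   below the true value at ybar k.+1. *)
have model k x z : Cf x -> Cg z ->
    f (xhat k.+1) + gamma k.+1 * bx (xhat k.+1) + dotv (A *m xhat k.+1) z
      - LA / (2 * gamma k.+1) * nY (z - yhat k) ^+ 2 - h z
    <= f x + dotv (A *m x) (ybar k.+1) + gamma k.+1 * bx x - h (ybar k.+1).
  move=> Cx Cz; have [Cxh xhmin] := xhatP k; have [Cyb ybmin] := ybarP k.
  have F_cvx : strongly_convex_on Cf nX (0 + gamma k.+1 * 1)
      (fun x => f x + gamma k.+1 * bx x + dotv (A^T *m yhat k) x).
    apply: strongly_convex_on_linear; apply: strongly_convex_onD => //.
    by apply: strongly_convex_onZ => //; exact: ltW.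
  have growth := min_quadratic_growth F_cvx Cxh xhmin Cx.
  have prox := ybmin _ Cz.
  have pair := pairing _ (x - xhat k.+1) (- 1 *: (ybar k.+1 - yhat k)) (gpos k).
  rewrite nYZ in pair.
  move: growth prox pair; rewrite !dotv_trmx !(dotvC (yhat k)).
  rewrite !(dotvBr, dotvZr, mulmxBr, dotvBl).
  lra.
elim=> [|k [Cxb IH]].
  have [Cxh _] := xhatP 0%N.
  have xb1 : xbar 1%N = xhat 1%N.
    by rewrite xbarE t0 subrr scale0r add0r scale1r.
  have yh0 : yhat 0%N = ydot.
    by rewrite yhatE t0 subrr scale0r add0r scale1r ys0.
  rewrite xb1; split=> // x y Cx Cy.
  apply: le_trans (model 0%N x y Cx Cy); rewrite yh0.
  have := bx0 _ Cxh; have := b_lb y Cy; have := bg 0%N; have := gpos 0%N.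
  rewrite t0 expr1n mulr1; set g1 := gamma 1%N; set b1 := beta 1%N => g0 LAE blb bxh.
  have -> : LA / (2 * g1) = b1 / 2 by rewrite -LAE; field; lra.
  have h1 := ler_wpM2l (bpos 0%N) blb; have h2 := mulr_ge0 (ltW g0) bxh.
  by rewrite -/b1 in h1; lra.
have [Cxh _] := xhatP k.+1; have ta := t01 k; have /andP[ta0 ta1] := ta.
have xbE := xbarE k.+1; set a := tau k.+1 in ta ta0 ta1 xbE.
have a1 : 0 < 1 - a < 1 by lra.
have [Cxb' fcvx] := cf _ _ _ Cxb Cxh a1.
have a1E : 1 - (1 - a) = a by lra.
rewrite a1E -xbE in Cxb' fcvx.
split=> // x y Cx Cy.
have [Cyb _] := ybarP k; have [Cys ysmin] := ystarP k.
have [Cz hcvx] := ch _ _ _ Cyb Cy a1; rewrite a1E in Cz hcvx.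
apply: le_trans (model k.+1 x _ Cx Cz).
have F_cvx : strongly_convex_on Cg nY (0 + beta k.+1 * 1)
    (fun y => h y + beta k.+1 * b y + dotv (- (A *m xbar k.+1)) y).
  apply: strongly_convex_on_linear; apply: strongly_convex_onD => //.
  exact: strongly_convex_onZ.
have growth := min_quadratic_growth F_cvx Cys ysmin Cy.
(* the invariant at the next primal point and at the old dual maximizer *)
have gap := IH _ _ Cxh Cys.
have -> : (1 - a) *: ybar k.+1 + a *: y - yhat k.+1 = a *: (y - ystar k.+1).
  by rewrite yhatE -/a; apply/colP => i; rewrite !mxE; lra.
rewrite nYZ.
have bgE := bg k.+1; rewrite -/a in bgE.
have -> : LA / (2 * gamma k.+2) * (a ^+ 2 * nY (y - ystar k.+1) ^+ 2) =
    beta k.+2 / 2 * nY (y - ystar k.+1) ^+ 2.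
  have g0 : gamma k.+2 != 0 by rewrite gt_eqF.
  by rewrite mulrA [_ / _ * a ^+ 2]mulrAC -bgE; field.
have both := ler_wpM2l (ltW (andP a1).1) (lerD growth gap).
rewrite brec -/a.
have bxh := mulr_ge0 (mulr_ge0 (sqr_ge0 a) (ltW (gpos k.+1))) (bx0 _ Cxh).
move: both fcvx hcvx bxh; rewrite grec -/a xbE.
rewrite !(mulmxDr, =^~ scalemxAr, dotvDr, dotvDl, dotvZr, dotvZl, dotvNl).
lra.
Qed.

(** * Extended-valued functions and conjugates *)

Lemma strongly_convex_on_sub (R : realType) (n : nat) (C D : set 'cV[R]_n)
    (nrm : 'cV[R]_n -> R) (mu nu : R) (F G : 'cV[R]_n -> R) :
  C `<=` D -> strongly_convex_on C nrm nu G ->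
  strongly_convex_on D nrm mu F -> strongly_convex_on C nrm mu F.
Proof.
move=> CD hG hF x y t Cx Cy t01; have [Cz _] := hG x y t Cx Cy t01.
by have [_ ?] := hF x y t (CD _ Cx) (CD _ Cy) t01.
Qed.

Lemma dom_fineK (R : realType) (n : nat) (F : 'cV[R]_n -> \bar R)
    (x : 'cV[R]_n) : (-oo < F x)%E -> dom F x -> F x = (fine (F x))%:E.
Proof. by move=> lo hi; rewrite fineK // fin_numElt lo. Qed.

Lemma strongly_convex_fine (R : realType) (n : nat) (nrm : 'cV[R]_n -> R)
    (mu : R) (F : 'cV[R]_n -> \bar R) :
  (forall x, (-oo < F x)%E) -> strongly_convex nrm mu F ->
  strongly_convex_on (dom F) nrm mu (fun x => fine (F x)).
Proof.
move=> Flo hF x y t Fx Fy t01; have := hF x y t t01.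
set z := (_ *: x + _)%R; rewrite [F x]dom_fineK // [F y]dom_fineK //.
rewrite -!EFinM -EFinD => le.
have Fz : dom F z.
  by move: le (Flo z); rewrite /dom /=; case: (F z) => // r _ _; rewrite ltry.
by split => //; move: le; rewrite [F z]dom_fineK // -EFinD lee_fin.
Qed.

Lemma convex_ext_fine (R : realType) (n : nat) (nrm : 'cV[R]_n -> R)
    (F : 'cV[R]_n -> \bar R) :
  (forall x, (-oo < F x)%E) -> convex_ext F ->
  strongly_convex_on (dom F) nrm 0 (fun x => fine (F x)).
Proof.
move=> Flo hF; apply: strongly_convex_fine => // x y t t01.
by rewrite !mul0r adde0; exact: hF.
Qed.

Lemma bregmanE (R : realType) (n : nat) (p : 'cV[R]_n -> \bar R)
    (dp : 'cV[R]_n -> 'cV[R]_n) (z c : 'cV[R]_n) :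
  Defs.proper p -> dom p z -> dom p c ->
  bregman p dp z c = (fine (p z) - fine (p c) - dotv (dp c) (z - c))%:E.
Proof.
by move=> [plo _] pz pc; rewrite /bregman [p z]dom_fineK // [p c]dom_fineK.
Qed.

Lemma prox_strongly_convex_on (R : realType) (q n : nat) (S : 'M[R]_(q, n))
    (Z : set 'cV[R]_n) (p : 'cV[R]_n -> \bar R) (dp : 'cV[R]_n -> 'cV[R]_n)
    (L : R) :
  prox_function (wnorm S) Z p dp L ->
  strongly_convex_on (dom p) (wnorm S) 1 (fun z => fine (p z)).
Proof.
by case=> [[plo _]] _ _ psc _ _ _; exact: strongly_convex_fine.
Qed.

Lemma bregman_strongly_convex_on (R : realType) (q n : nat) (S : 'M[R]_(q, n))
    (Z : set 'cV[R]_n) (p : 'cV[R]_n -> \bar R) (dp : 'cV[R]_n -> 'cV[R]_n)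
    (L : R) (c : 'cV[R]_n) :
  prox_function (wnorm S) Z p dp L -> dom p c ->
  strongly_convex_on (dom p) (wnorm S) 1 (fun z => fine (bregman p dp z c)).
Proof.
move=> hp pc x y t px py t01.
have [pz le] := prox_strongly_convex_on hp px py t01.
have pp := prox_proper hp.
split => //; rewrite !bregmanE //= !dotvBr dotvDr !dotvZr; lra.
Qed.

Lemma bregman_ge_half_sqr (R : realType) (q n : nat) (S : 'M[R]_(q, n))
    (Z : set 'cV[R]_n) (p : 'cV[R]_n -> \bar R) (dp : 'cV[R]_n -> 'cV[R]_n)
    (L : R) (z c : 'cV[R]_n) :
  prox_function (wnorm S) Z p dp L -> dom p c -> dom p z ->
  1 / 2 * wnorm S (z - c) ^+ 2 <= fine (bregman p dp z c).
Proof.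
move=> hp pc pz; rewrite bregmanE //=; last exact: prox_proper hp.
exact: (bregman_lower_bound (wnorm0 S) (prox_strongly_convex_on hp)
  (prox_gradient hp) pc pz).
Qed.

(** The Bregman distances from [z] to [c] and from [c] to [z] add up to the
    increment of the gradient paired with [z - c]; both are nonnegative, so each
    is at most the sum. *)
Lemma bregman_le_sqr (R : realType) (q n : nat) (S : 'M[R]_(q, n))
    (Z : set 'cV[R]_n) (p : 'cV[R]_n -> \bar R) (dp : 'cV[R]_n -> 'cV[R]_n)
    (L : R) (z c : 'cV[R]_n) :
  posdef (S^T *m S) -> prox_function (wnorm S) Z p dp L -> dom p c -> dom p z ->
  fine (bregman p dp z c) <= L * wnorm S (z - c) ^+ 2.
Proof.
move=> hS hp pc pz; have pp := prox_proper hp.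
have := bregman_ge_half_sqr hp pz pc; rewrite !bregmanE //=.
have := dotv_le_dual_norm (dp z - dp c) (z - c) hS.
have := ler_wpM2r (wnorm_ge0 S (z - c)) (prox_lipschitz_gradient hp pz pc).
have := sqr_ge0 (wnorm S (c - z)).
rewrite dotvBl -(opprB z c) dotvNr expr2; lra.
Qed.

Lemma conjugate_ge (R : realType) (n : nat) (g : 'cV[R]_n -> \bar R)
    (y u : 'cV[R]_n) : ((dotv y u)%:E - g u <= conjugate g y)%E.
Proof. by apply: ereal_sup_ubound; exists u. Qed.

Lemma conjugate_gtNy (R : realType) (n : nat) (g : 'cV[R]_n -> \bar R)
    (y : 'cV[R]_n) : Defs.proper g -> (-oo < conjugate g y)%E.
Proof.
move=> [glo [u gu]]; apply: lt_le_trans (conjugate_ge g y u).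
by rewrite [g u]dom_fineK // ltNyr.
Qed.

Lemma fenchel_young (R : realType) (n : nat) (g : 'cV[R]_n -> \bar R)
    (y u : 'cV[R]_n) : Defs.proper g -> dom g u -> dom (conjugate g) y ->
  dotv y u <= fine (g u) + fine (conjugate g y).
Proof.
move=> gp gu hy; have := conjugate_ge g y u.
rewrite [g u]dom_fineK //; last exact: gp.1.
rewrite [conjugate g y]dom_fineK //; last exact: conjugate_gtNy.
by rewrite -EFinB lee_fin; lra.
Qed.

Lemma conjugate_strongly_convex_on (R : realType) (n : nat)
    (nrm : 'cV[R]_n -> R) (g : 'cV[R]_n -> \bar R) : Defs.proper g ->
  strongly_convex_on (dom (conjugate g)) nrm 0 (fun y => fine (conjugate g y)).
Proof.
move=> gp x y t hx hy t01.
have le : (conjugate g (t *: x + (1 - t) *: y) <=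
    (t * fine (conjugate g x) + (1 - t) * fine (conjugate g y))%:E)%E.
  apply: ge_ereal_sup => _ [u _ <-].
  have := gp.1 u; case gu : (g u) => [r| |] // _; last by rewrite leNye.
  have du : dom g u by rewrite /dom /= gu ltry.
  have hx' := fenchel_young gp du hx; have hy' := fenchel_young gp du hy.
  rewrite gu /= in hx' hy'.
  rewrite -EFinB lee_fin dotvDl !dotvZl.
  have t0 : 0 <= t by lra.
  have t1 : 0 <= 1 - t by lra.
  have := ler_wpM2l t0 hx'; have := ler_wpM2l t1 hy'; lra.
have hz : dom (conjugate g) (t *: x + (1 - t) *: y).
  exact: le_lt_trans le (ltry _).
split => //; move: le; rewrite [conjugate g _]dom_fineK //; last first.
  exact: conjugate_gtNy.
by rewrite lee_fin; lra.
Qed.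

(** The witness is a subgradient of [g] at [u]. Together with the Fenchel-Young
    inequality this says that [g] equals its biconjugate at [u], with the supremum
    attained. *)
Lemma fenchel_equality_attained (R : realType) (n : nat)
    (g : 'cV[R]_n -> \bar R) (u : 'cV[R]_n) :
  (forall x, g x \is a fin_num) -> convex_ext g ->
  exists y, dom (conjugate g) y /\
    fine (g u) + fine (conjugate g y) <= dotv y u.
Proof.
move=> gfin gc.
have glo x : (-oo < g x)%E by have := gfin x; rewrite fin_numElt => /andP[].
have gd x : dom g x by have := gfin x; rewrite fin_numElt => /andP[].
have [|y hy] := @subgradient_exists R n (fun x => fine (g x)) _ u.
  move=> x z t t01.
  by have [_] := convex_ext_fine (fun=> 0) glo gc (gd x) (gd z) t01; lra.
have le : (conjugate g y <= (dotv y u - fine (g u))%:E)%E.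
  apply: ge_ereal_sup => _ [v _ <-].
  rewrite [g v]dom_fineK // -EFinB lee_fin.
  by have := hy v; rewrite dotvBr; lra.
exists y; have hd : dom (conjugate g) y by exact: le_lt_trans le (ltry _).
split => //; move: le; rewrite [conjugate g y]dom_fineK //; last first.
  by apply: conjugate_gtNy; split=> //; exists u.
by rewrite lee_fin; lra.
Qed.

(** A slope steeper than the Lipschitz constant cannot minorize [g], even up to
    an additive constant. *)
Lemma lipschitz_dom_conjugate_bounded (R : realType) (n : nat)
    (g : 'cV[R]_n -> \bar R) : lipschitz_ext g ->
  exists K, forall y, dom (conjugate g) y -> forall i, `|y i 0| <= K.
Proof.
move=> [gfin [K0 [_ /(_ (`|K0| + 1))]]].
rewrite ltr_pwDr ?ler_norm // => /(_ isT) glip.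
have glo x : (-oo < g x)%E by have := gfin x; rewrite fin_numElt => /andP[].
have gd x : dom g x by have := gfin x; rewrite fin_numElt => /andP[].
have gp : Defs.proper g by split=> //; exists 0.
exists (`|K0| + 1) => y hy i; set K := `|K0| + 1 in glip *.
have K_ge0 : 0 <= K by rewrite addr_ge0.
set c := fine (conjugate g y) + fine (g 0).
(* Fenchel-Young on the half of the i-th axis where the pairing with y is >= 0 *)
have ray t : 0 < t -> t * (`|y i 0| - K) <= c.
  move=> t0; pose u : 'cV[R]_n := (t * Num.sg (y i 0)) *: delta_mx i 0.
  have := fenchel_young gp (gd u) hy.
  have -> : dotv y u = t * `|y i 0|.
    by rewrite dotvZr dotvC dotvE trmx_delta -rowE mxE normrEsg; ring.
  have := glip (u, 0) (conj I I); rewrite /= subr0.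
  have un : `|u| <= t.
    rewrite [`|u|]mx_normrE; apply/bigmax_leP; split; first exact: ltW.
    move=> [k l] _ /=; rewrite !mxE !normrM gtr0_norm // -mulrA.
    rewrite -[leRHS]mulr1 ler_pM2l // normr_sg normr_nat -natrM lern1.
    by case: (_ != _); case: (_ && _).
  move=> /(le_trans (ler_norm _)) h1; have := ler_wpM2l K_ge0 un.
  by rewrite /c; lra.
rewrite leNgt; apply/negP => lt.
have c1 : 0 < `|c| + 1 by rewrite ltr_wpDl.
have := ray ((`|c| + 1) / (`|y i 0| - K)); rewrite divr_gt0 ?subr_gt0 // => /(_ isT).
rewrite divfK ?gt_eqF ?subr_gt0 //; have := ler_norm c; lra.
Qed.

(** * The convergence rate *)

Theorem theorem4p3 (R : realType) (n m qX qY : nat)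
    (f : 'cV[R]_n -> \bar R) (g : 'cV[R]_m -> \bar R) (A : 'M[R]_(m, n))
    (SX : 'M[R]_(qX, n)) (SY : 'M[R]_(qY, m))
    (pX : 'cV[R]_n -> \bar R) (dpX : 'cV[R]_n -> 'cV[R]_n) (LbX : R)
    (pY : 'cV[R]_m -> \bar R) (dpY : 'cV[R]_m -> 'cV[R]_m) (LbY : R)
    (xdot : 'cV[R]_n) (ydot : 'cV[R]_m) (gamma1 : R)
    (tau gamma beta : nat -> R)
    (xbar xhat : nat -> 'cV[R]_n) (ybar yhat ystar : nat -> 'cV[R]_m)
    (hf : proper_closed_convex f) (hg : proper_closed_convex g)
    (hA : A != 0)
    (hsol : primal_sol f g A !=set0)
    (hri : relint [set u - A *m x | u in dom g & x in dom f] 0)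
    (hSX : posdef (SX^T *m SX)) (hSY : posdef (SY^T *m SY))
    (hpX : prox_function (wnorm SX) (closure (dom f)) pX dpX LbX)
    (hpY : prox_function (wnorm SY) (closure (dom (conjugate g))) pY dpY LbY)
    (hxdot : closure (dom f) xdot)
    (hgamma1 : 0 < gamma1)
    (hglip : lipschitz_ext g)
    (hydot : normalized_prox_center pY ydot)
    (hLbX : LbX = 1)
    (halg : ADSGARD f g A (wnorm SX) (wnorm SY)
              (bregman pX dpX) (bregman pY dpY) LbX gamma1 xdot ydot
              tau gamma beta xbar xhat ybar yhat ystar) :
  let LA := opnorm_sq (wnorm SX) (wnorm SY) A in
  let DY := ereal_sup
    [set bregman pY dpY y ydot | y in dom (conjugate g)] in
  (DY < +oo)%E /\
  forall (k : nat) (xstar : 'cV[R]_n), (1 <= k)%N -> primal_sol f g A xstar ->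
    (primal f g A (xbar k) - primal_opt f g A
     <= (2 * gamma1 / (k%:R + 1))%:E * bregman pX dpX xstar xdot
        + (2 * LA / (gamma1 * k%:R))%:E * DY)%E.
Proof.
move=> LA DY.
case: hf => [[flo fne] _ fcvx].
case: hg => gp _ gcvx; case: hydot => [[ydom _] _].
have [gfin _] := hglip.
have gd u : dom g u by have := gfin u; rewrite fin_numElt => /andP[].
have glo := gp.1.
have clo y := conjugate_gtNy y gp.
have pXp := prox_proper hpX; have pYp := prox_proper hpY.
have domX x : dom f x -> dom pX x.
  by move=> fx; apply: (prox_sub_dom hpX); exact: subset_closure.
have domY y : dom (conjugate g) y -> dom pY y.
  by move=> gy; apply: (prox_sub_dom hpY); exact: subset_closure.
have xdom : dom pX xdot by exact: (prox_sub_dom hpX).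
pose fr x := fine (f x); pose gr u := fine (g u).
pose h y := fine (conjugate g y).
pose bx x := fine (bregman pX dpX x xdot).
pose b y := fine (bregman pY dpY y ydot).
have fE x : dom f x -> f x = (fr x)%:E by exact: dom_fineK.
have gE u : g u = (gr u)%:E by rewrite /gr fineK.
have hE y : dom (conjugate g) y -> conjugate g y = (h y)%:E by exact: dom_fineK.
have bxE x : dom pX x -> bregman pX dpX x xdot = (bx x)%:E.
  by move=> px; rewrite /bx bregmanE.
have bE y : dom pY y -> bregman pY dpY y ydot = (b y)%:E.
  by move=> py; rewrite /b bregmanE.
have b_lb y : dom (conjugate g) y -> 1 / 2 * wnorm SY (y - ydot) ^+ 2 <= b y.
  by move=> /domY; exact: bregman_ge_half_sqr hpY ydom.
have b_ge0 y : dom (conjugate g) y -> 0 <= b y.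
  by move=> /b_lb; have := sqr_ge0 (wnorm SY (y - ydot)); lra.
have bx_ge0 x : dom f x -> 0 <= bx x.
  move=> /domX/(bregman_ge_half_sqr hpX xdom).
  by have := sqr_ge0 (wnorm SX (x - xdot)); rewrite -/(bx x); lra.
have [y0 [y0dom _]] := fenchel_equality_attained 0 gfin gcvx.
have [D DE] : exists D, DY = D%:E.
  suff DYfin : (DY < +oo)%E.
    exists (fine DY); rewrite fineK // fin_numElt DYfin andbT.
    apply: (@lt_le_trans _ _ (b y0)%:E); first exact: ltNyr.
    by apply: ereal_sup_ubound; exists y0 => //; apply/bE/domY.
  have [K Kb] := lipschitz_dom_conjugate_bounded hglip.
  pose B := \sum_i (\sum_j `|SY i j| * (K + `|ydot j 0|)) ^+ 2.
  apply: (@le_lt_trans _ _ (LbY * B)%:E); last exact: ltry.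
  apply: ge_ereal_sup => _ [y yd <-]; rewrite bE ?lee_fin; last exact: domY.
  apply: le_trans (bregman_le_sqr hSY hpY ydom (domY _ yd)) _.
  apply: ler_wpM2l; first exact: le_trans ler01 (prox_constant_ge1 hpY).
  apply: le_trans (@wnorm_sqr_le _ _ _ SY _ (\col_j (K + `|ydot j 0|)) _) _.
    move=> j; rewrite !mxE; apply: le_trans (ler_normB _ _) _.
    by rewrite lerD2r; exact: Kb.
  apply/ler_sum => i _; rewrite le_eqVlt; apply/orP; left; apply/eqP.
  by congr (_ ^+ 2); apply: eq_bigr => j _; rewrite mxE.
have b_le y : dom (conjugate g) y -> b y <= D.
  move=> yd; rewrite -lee_fin -DE -bE; last exact: domY.
  by apply: ereal_sup_ubound; exists y.
split=> [|k xstar k1 [_ xs_min]]; first by rewrite DE ltry.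
(* Each subproblem has a finite value at some point, so its solution lies in
   the effective domain and its optimality can be stated with real numbers. *)
have LbX1 : LbX^-1 = 1 by rewrite hLbX invr1.
have t0 := adsgard_tau0 halg; have g1 := adsgard_gamma1 halg.
have b1 := adsgard_beta1 halg; rewrite -/LA in b1.
have t01 j : 0 < tau j.+1 < 1 by have [] := adsgard_tau halg j.
have tpos j : 0 < tau j.+1 by have /andP[] := t01 j.
have trec j : tau j.+1 ^+ 2 * (1 + tau j.+1) = tau j ^+ 2 * (1 - tau j.+1).
  by have [_] := adsgard_tau halg j; rewrite LbX1 mulr1; lra.
have grec j : gamma j.+2 = gamma j.+1 / (1 + tau j.+1).
  by rewrite (adsgard_gamma halg) LbX1 mul1r.
have brec := adsgard_beta halg.
have LA0 : 0 <= LA by exact: opnorm_sq_ge0.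
have tlow := tau_lower_bound t0 t01 trec.
have gb := gamma_bounds hgamma1 g1 tpos tlow grec.
have bb := beta_bounds (divr_ge0 LA0 (ltW hgamma1)) b1 t01 tlow brec.
have bg := beta_gamma_product hgamma1 g1 b1 t0 tpos trec grec brec.
have gpos j : 0 < gamma j.+1 by have /andP[] := gb j.
have bpos j : 0 <= beta j.+1 by have /andP[] := bb j.
have f_sc := convex_ext_fine (wnorm SX) flo fcvx.
have h_sc := conjugate_strongly_convex_on (wnorm SY) gp.
have bx_sc := strongly_convex_on_sub domX f_sc
  (bregman_strongly_convex_on hpX xdom).
have b_sc := strongly_convex_on_sub domY h_sc
  (bregman_strongly_convex_on hpY ydom).
have xhatP j : dom f (xhat j.+1) /\ forall x, dom f x ->
     fr (xhat j.+1) + gamma j.+1 * bx (xhat j.+1)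
       + dotv (A^T *m yhat j) (xhat j.+1)
     <= fr x + gamma j.+1 * bx x + dotv (A^T *m yhat j) x.
  have [xcl xmin] := adsgard_xhat halg j.
  have xpX := prox_sub_dom hpX xcl.
  have xd : dom f (xhat j.+1).
    have [x1 fx1] := fne; have := xmin _ (subset_closure fx1).
    rewrite bxE // (bxE _ (domX _ fx1)) (fE _ fx1) -!EFinM -!EFinD /dom /=.
    by move: (flo (xhat j.+1)); case: (f _) => // r _ _; rewrite ltry.
  split=> // x xd'; have := xmin _ (subset_closure xd').
  rewrite !bxE; [|exact: domX|exact: domX]; rewrite !fE // -!EFinM -!EFinD lee_fin.
  lra.
have ybarP j : dom (conjugate g) (ybar j.+1) /\
    forall y, dom (conjugate g) y ->
     h (ybar j.+1) - dotv (A *m xhat j.+1) (ybar j.+1 - yhat j)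
       + LA / (2 * gamma j.+1) * wnorm SY (ybar j.+1 - yhat j) ^+ 2
     <= h y - dotv (A *m xhat j.+1) (y - yhat j)
       + LA / (2 * gamma j.+1) * wnorm SY (y - yhat j) ^+ 2.
  have [_ ymin] := adsgard_ybar halg j.
  have yd : dom (conjugate g) (ybar j.+1).
    have := ymin y0 I; rewrite (hE _ y0dom) -EFinB -EFinD /dom /=.
    by move: (clo (ybar j.+1)); case: (conjugate g _) => // r _ _; rewrite ltry.
  split=> // y yd'; have := ymin y I.
  by rewrite !hE // -!EFinB -!EFinD lee_fin.
have ystarP j : dom (conjugate g) (ystar j.+1) /\
    forall y, dom (conjugate g) y ->
     h (ystar j.+1) + beta j.+1 * b (ystar j.+1)
       + dotv (- (A *m xbar j.+1)) (ystar j.+1)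
     <= h y + beta j.+1 * b y + dotv (- (A *m xbar j.+1)) y.
  have [ycl ymax] := adsgard_ystar halg j.
  have ypY := prox_sub_dom hpY ycl.
  have yd : dom (conjugate g) (ystar j.+1).
    have := ymax _ (subset_closure y0dom).
    rewrite (bE _ ypY) (bE _ (domY _ y0dom)) (hE _ y0dom).
    rewrite -!EFinM -!EFinB /dom /=.
    by move: (clo (ystar j.+1)); case: (conjugate g _) => // r _ _; rewrite ltry.
  split=> // y yd'; have := ymax _ (subset_closure yd').
  rewrite (bE _ ypY) (bE _ (domY _ yd')) !hE // -!EFinM -!EFinB lee_fin !dotvNl.
  lra.
case: k k1 => // k _.
have grec' j : gamma j.+1 = (1 + tau j.+1) * gamma j.+2.
  by rewrite grec mulrC divfK // gt_eqF // addr_gt0.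
have [xbd gap] := gap_estimate f_sc bx_sc h_sc b_sc bx_ge0 b_lb
  (fun a y => wnormZ_sqr SY a y)
  (fun c x y => @dotv_mulmx_le _ _ _ _ _ A SX SY c x y hSX hSY)
  t0 t01 gpos bpos bg grec' brec
  (adsgard_ystar0 halg) (adsgard_yhat halg) (adsgard_xbar halg)
  xhatP ybarP ystarP k.
have xsd : dom f xstar.
  have [x1 fx1] := fne; have := xs_min x1 I.
  rewrite /primal !gE (fE _ fx1) /dom /=.
  by move: (flo xstar); case: (f xstar) => // r _ _; rewrite ltry.
have optE : primal_opt f g A = primal f g A xstar.
  apply/eqP; rewrite eq_le; apply/andP; split.
    by apply: ereal_inf_lbound; exists xstar.
  by apply: le_ereal_inf_tmp => _ [x _ <-]; exact: xs_min.
rewrite optE /primal !gE !fE // (bxE _ (domX _ xsd)) DE.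
rewrite -!EFinM -!EFinD lee_fin.
have [y [yd yeq]] := fenchel_equality_attained (A *m xbar k.+1) gfin gcvx.
have est := gap _ _ xsd yd.
have [ybd _] := ybarP k.
have fy := fenchel_young gp (gd (A *m xstar)) ybd.
have /andP[_ gle] := gb k; have /andP[_ ble] := bb k.
have D0 : 0 <= D by apply: le_trans (b_ge0 _ yd) (b_le _ yd).
have gbx := ler_wpM2r (bx_ge0 _ xsd) gle.
have bD := ler_wpM2l (bpos k) (b_le _ yd).
have bD' := ler_wpM2r D0 ble.
have K0 : (0 : R) <= k%:R by exact: ler0n.
have slack : LA / gamma1 / (k%:R + 1) * D <= 2 * LA / (gamma1 * k.+1%:R) * D.
  have q0 : 0 <= LA / gamma1 / (k%:R + 1) * D.
    by rewrite mulr_ge0 // divr_ge0 ?addr_ge0 // divr_ge0 // ltW.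
  by rewrite -[k.+1%:R]natr1 -(mulrA 2) invfM (mulrA LA); lra.
have kE : k.+1%:R + 1 = k%:R + 2 :> R by rewrite -[k.+1%:R]natr1; lra.
rewrite kE; rewrite (dotvC (A *m xbar k.+1)) (dotvC (A *m xstar)) in est.
rewrite /h /fr /gr /bx /b in est yeq fy gbx bD *.
by move: gbx (le_trans bD (le_trans bD' slack)) est fy yeq;
  move: (_ / (k%:R + 2)) (_ / (gamma1 * _)) => c1 c2; lra.
Qed.
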